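(* Let $k$ be an integer, let $N$ be an odd positive integer, and let $m_1,m_2$ be square-free positive integers such that $m_1\mid N$ and $(N,m_2)=1$. Let $\phi\in J_{k,m_1m_2}(N)$ be a non-zero Jacobi form of weight $k$, index $m_1m_2$ and level $N$, with theta components $h_\mu$ ($\mu \bmod 2m_1m_2$). Then there exists $\mu \bmod 2m_1m_2$ with either $(\mu,2m_1m_2)=1$ or $(\mu,2m_1m_2)\nmid 2m_2$ such that $h_\mu\neq 0$.
   Context: Notation: $(a,b)$ is the greatest common divisor, $e(z)=e^{2\pi i z}$, $e^m(z)=e^{2\pi i m z}$, and $\mathbb{H}$ is the complex upper half plane. Jacobi forms. A holomorphic function $\phi:\mathbb{H}\times\mathbb{C}\to\mathbb{C}$ is a Jacobi form of weight $k$, index $m$ and level $N$ if: (1) $\phi\left(\frac{a\tau+b}{c\tau+d},\frac{z}{c\tau+d}\right)(c\tau+d)^{-k}e^m\left(\frac{-cz^2}{c\tau+d}\right)=\phi(\tau,z)$ for all $\begin{pmatrix}a&b\\c&d\end{pmatrix}\in\Gamma_0(N)$; (2) $\phi(\tau,z+\lambda\tau+\mu)e^m(\lambda^2\tau+2\lambda z)=\phi(\tau,z)$ for all $(\lambda,\mu)\in\mathbb{Z}^2$; (3) $\phi$ is bounded at the cusps, i.e. for every $\gamma=\begin{pmatrix}a&b\\c&d\end{pmatrix}\in\mathrm{SL}(2,\mathbb{Z})$ the function $\phi\left(\frac{a\tau+b}{c\tau+d},\frac{z}{c\tau+d}\right)(c\tau+d)^{-k}e^m\left(\frac{-cz^2}{c\tau+d}\right)$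 has a Fourier expansion $\sum c_\gamma(n,r)e(n\tau)e(rz)$, over $r\in\mathbb{Z}$ and rational $n$ with bounded denominator, supported on $4nm-r^2\ge 0$. The space of these is $J_{k,m}(N)$. Theta components. Any $\phi\in J_{k,m}(N)$ has a unique theta expansion $\phi(\tau,w)=\sum_{\mu \bmod 2m}h_\mu(\tau)\,\Theta_{\mu,m}(\tau,w)$, where $\Theta_{\mu,m}(\tau,w)=\sum_{n\in\mathbb{Z}}e\left(\frac{(2mn-\mu)^2}{4m}\tau+(2mn-\mu)w\right)$ and the $h_\mu$ are holomorphic functions on $\mathbb{H}$, called the theta components of $\phi$. *)

(* Defs.v *)
From HB Require Import structures.
From mathcomp Require Import all_boot all_order all_algebra.
From mathcomp Require Import finmap.
From mathcomp Require Import all_classical all_reals all_analysis.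
From mathcomp Require Export complex.

Set Implicit Arguments.
Unset Strict Implicit.
Unset Printing Implicit Defensive.

Import Order.TTheory GRing.Theory Num.Theory.
Import numFieldNormedType.Exports.

Local Open Scope classical_set_scope.
Local Open Scope ring_scope.
Local Open Scope complex_scope.

Definition squarefree (n : nat) : Prop :=
  forall d : nat, (d ^ 2 %| n)%N -> d = 1%N.

(* Unconditional summation: the net of finite partial sums, indexed by the
   finite subsets of I ordered by inclusion, converges to s. *)
Definition totally {I : choiceType} : set_system {fset I} :=
  filter_from setT (fun A : {fset I} => [set B | (A `<=` B)%fset]).

Definition has_sum (R : realType) (I : choiceType) (f : I -> R[i]) (s : R[i])
    : Prop :=
  (fun A : {fset I} => \sum_(i <- A) f i : R[i]^o)
    @ totally --> (s : R[i]^o).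

(* 0 if the family is not summable *)
Definition usum (R : realType) (I : choiceType) (f : I -> R[i]) : R[i] :=
  xget 0 [set s | has_sum f s].

Section JacobiForms.
Context {R : realType}.
Local Notation C := R[i].

Definition cexp (z : C) : C :=
  (expR (complex.Re z))%:C * (cos (complex.Im z) +i* sin (complex.Im z)).

Definition e (z : C) : C := cexp (2 * (pi : R)%:C * 'i%C * z).

Definition upper_half : set C := [set tau | 0 < complex.Im tau].

(* Functions on the upper half plane are represented by total functions on C;
   only their values at points of upper_half are ever constrained. *)
Definition holomorphicH (h : C -> C) : Prop :=
  forall tau, upper_half tau -> differentiable (h : C^o -> C^o) (tau : C^o).

(* C-differentiability of phi as a function of the pair (tau, z) *)
Definition holomorphicHC (phi : C -> C -> C) : Prop :=
  forall tau z : C, upper_half tau ->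
    differentiable (fun p : C^o * C^o => phi p.1 p.2 : C^o) ((tau, z) : C^o * C^o).

Definition SL2Z : set 'M[int]_2 := [set g | \det g = 1].

Definition Gamma0 (N : nat) : set 'M[int]_2 :=
  [set g | \det g = 1 /\ (N %| g ord_max ord0)%Z].

Definition slash (k : int) (m : nat) (phi : C -> C -> C) (g : 'M[int]_2)
    (tau z : C) : C :=
  let a := (g ord0 ord0)%:~R in let b := (g ord0 ord_max)%:~R in
  let c := (g ord_max ord0)%:~R in let d := (g ord_max ord_max)%:~R in
  phi ((a * tau + b) / (c * tau + d)) (z / (c * tau + d))
    * (c * tau + d) ^ (- k) * e (m%:R * (- c * z ^+ 2 / (c * tau + d))).

Definition bounded_at_cusps (k : int) (m : nat) (phi : C -> C -> C) : Prop :=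
  forall g, SL2Z g ->
  exists c : rat -> int -> C,
    [/\ exists B : int, forall n r, c n r != 0 -> denq n <= B,
        forall n r, c n r != 0 -> 0 <= 4 * n * m%:R - r%:~R ^+ 2 &
        forall tau z : C, upper_half tau ->
          has_sum (fun nr : rat * int =>
              c nr.1 nr.2 * e (ratr nr.1 * tau) * e (nr.2%:~R * z))
            (slash k m phi g tau z)].

Record jacobi_form (k : int) (m N : nat) (phi : C -> C -> C) : Prop :=
  JacobiForm {
    jacobi_holomorphic : holomorphicHC phi;
    jacobi_modular : forall g (tau z : C), Gamma0 N g -> upper_half tau ->
      slash k m phi g tau z = phi tau z;
    jacobi_elliptic : forall (la mu : int) (tau z : C), upper_half tau ->
      phi tau (z + la%:~R * tau + mu%:~R)
        * e (m%:R * (la%:~R ^+ 2 * tau + 2 * la%:~R * z)) = phi tau z;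
    jacobi_cusps : bounded_at_cusps k m phi
  }.

Definition Theta (mu : int) (m : nat) (tau w : C) : C :=
  usum (fun n : int =>
    let r : C := (2 * m%:R * n - mu)%:~R in
    e (r ^+ 2 / (4 * m%:R) * tau + r * w)).

(* The classes mu mod 2m are represented by 0 <= mu < 2m; the h mu are
   determined by phi on the upper half plane. *)
Definition theta_components (m : nat) (phi : C -> C -> C)
    (h : 'I_(2 * m) -> C -> C) : Prop :=
  (forall mu, holomorphicH (h mu)) /\
  (forall tau w : C, upper_half tau ->
    phi tau w = \sum_(mu < 2 * m) h mu tau * Theta mu%:Z m tau w).

End JacobiForms.

(* Main.v *)
Require Import Defs.
From mathcomp Require Import all_boot all_order all_algebra.
From mathcomp Require Import all_classical all_reals all_analysis.
From mathcomp Require Import ring lra.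

Set Implicit Arguments.
Unset Strict Implicit.
Unset Printing Implicit Defensive.

Import Order.TTheory GRing.Theory Num.Theory.

Local Open Scope ring_scope.
Local Open Scope complex_scope.

(** Why the theorem holds.  Write m = m1 m2.  Suppose that h_mu vanishes for all
mu that are coprime to 2m or have (mu,2m) not dividing 2 m2.  Then every mu
with h_mu <> 0 is divisible by some prime p | 2 m2, and for such mu the
function Theta_mu(tau,z), whose frequencies in z are all divisible by p, has
period 1/p in z.  With V_p f(z) = f(z + 1/p), the product of the commuting
operators 1 - V_p over all primes p | 2 m2 therefore kills phi
([Theta_periodic], [sieve_sum], [sieve_eq0]).

The modularity of phi removes the factors of this product one at a time
([sieve_cons_eq0]).  The shift V_p is one of the Heisenberg operators
  U_(x,y) f(z) = f(z + x tau + y) e(m (x^2 tau + 2 x z + x y)),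
and the slash action of g carries U_X to U_(Xg) ([slash_shift]).  Let p be one
of the primes, v the result of applying the factors other than that of p to
phi, so that V_p v = v.  Choose c divisible by N and by q^2 for each other
prime q, but not by p; this is possible since p does not divide N.  The
matrices with rows (1,0), (c,1) and (1,1), (c,c+1) belong to Gamma0(N), and
because their bottom rows are q-adically close to (0,1) for each q they fix v,
not only phi ([slash_sieve]).  Transporting V_p v = v by them shows that v is fixed by
U_X and by U_(X+Y), where X = (c/p, 1/p) and Y = (0, c/p); it is fixed by
U_Y too, a power of V_p.  But U_X and U_Y compose to U_(X+Y) only up to the
scalar e(m c^2/p^2), which differs from 1 because p^2 does not divide m.
Hence v = 0.  After all primes are removed this says phi = 0. *)

(** * The exponential e *)

Lemma cexpD (R : realType) (z w : R[i]) : cexp (z + w) = cexp z * cexp w.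
Proof.
case: z w => [x y] [x' y']; rewrite /cexp /= expRD cosD sinD.
by apply/eqP; rewrite eq_complex /=; apply/andP; split; apply/eqP; ring.
Qed.

Lemma eD (R : realType) (z w : R[i]) : e (z + w) = e z * e w.
Proof. by rewrite /e mulrDr cexpD. Qed.

Lemma e_real (R : realType) (x : R) :
  e x%:C = cos (2 * (pi * x)) +i* sin (2 * (pi * x)).
Proof.
rewrite /e.
have -> : 2 * pi%:C * 'i%C * x%:C = 0 +i* (2 * (pi * x)) :> R[i].
  by apply/eqP; rewrite eq_complex /=; apply/andP; split; apply/eqP; ring.
rewrite /cexp /= expR0.
by apply/eqP; rewrite eq_complex /=; apply/andP; split; apply/eqP; ring.
Qed.

Lemma e_nat (R : realType) (n : nat) : e (n%:R : R[i]) = 1.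
Proof.
have e0 : e (0 : R[i]) = 1.
  by have := e_real (0 : R); rewrite !mulr0 cos0 sin0.
have e1 : e (1 : R[i]) = 1.
  have := e_real (1 : R).
  by rewrite mulr1 mulr_natl cos2pi -[pi *+ 2]add0r sinD2pi sin0.
by elim: n => [//|n IHn]; rewrite -natr1 eD IHn e1 mulr1.
Qed.

Lemma e_int (R : realType) (n : int) : e (n%:~R : R[i]) = 1.
Proof.
case: n => n; first by rewrite e_nat.
rewrite NegzE mulrNz; have := eD (- (n.+1%:R)) (n.+1%:R : R[i]).
by rewrite addNr e_nat mulr1 (e_nat R 0).
Qed.

Lemma e_eqD_int (R : realType) (z w : R[i]) (n : int) :
  z = w + n%:~R -> e z = e w.
Proof. by move=> ->; rewrite eD e_int mulr1. Qed.

(** Modulo an integer the argument is r/n with 0 <= r < n.  If r were positive,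
the real part cos(2 pi r/n) = 1 - 2 sin(pi r/n)^2 would be less than 1. *)
Lemma e_frac_eq1 (R : realType) (u n : nat) :
  (0 < n)%N -> e (u%:R / n%:R : R[i]) = 1 -> (n %| u)%N.
Proof.
move=> n0 eu.
have eq_u : (u%:R / n%:R : R[i]) =
    ((u %% n)%:R / n%:R : R)%:C + (u %/ n)%:R.
  have nz : n%:R != 0 :> R[i] by rewrite pnatr_eq0 -lt0n.
  rewrite rmorphM fmorphV !rmorph_nat {1}(divn_eq u n) natrD natrM.
  by field.
move: eu; rewrite eq_u eD e_nat mulr1 e_real => -[cos1 _].
apply: contraT => ndvd.
have nR0 : 0 < n%:R :> R by rewrite ltr0n.
have r0 : 0 < (u %% n)%:R :> R by rewrite ltr0n lt0n.
have s0 : 0 < sin (pi * ((u %% n)%:R / n%:R) : R).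
  apply: sin_gt0_pi; rewrite mulr_gt0 ?pi_gt0 ?divr_gt0 //=.
  rewrite -[ltRHS]mulr1 ltr_pM2l ?pi_gt0 // ltr_pdivrMr // mul1r ltr_nat.
  exact: ltn_pmod.
move: cos1; rewrite mulr_natl mulr2n cosD -!expr2 cos2sin2 => cos1.
have : 0 < sin (pi * ((u %% n)%:R / n%:R) : R) ^+ 2 by rewrite exprn_gt0.
by move: cos1; lra.
Qed.

(** * Moebius transformations of the upper half plane *)

Lemma moebius_denom_neq0 (R : realType) (tau : R[i]) (a b c d : int) :
  a * d - b * c = 1 -> upper_half tau -> c%:~R * tau + d%:~R != 0.
Proof.
case: tau => x y det1 /=; rewrite /upper_half /= => y0; apply/negP => /eqP J0.
have [E1 E2] : (c%:~R * x + d%:~R = 0 :> R) /\ (c%:~R * y = 0 :> R).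
  move: J0; rewrite -!(rmorph_int (real_complex R)).
  move/eqP; rewrite eq_complex /= => /andP[/eqP E1 /eqP E2].
  by split; [move: E1|move: E2]; lra.
have c0 : c%:~R = 0 :> R.
  by apply/eqP; move/eqP: E2; rewrite mulf_eq0 (gt_eqF y0) orbF.
move/eqP: E1; rewrite c0 mul0r add0r intr_eq0 => /eqP d0.
move/eqP: c0; rewrite intr_eq0 => /eqP c0.
by move: det1; rewrite c0 d0 !mulr0.
Qed.

Lemma moebius_upper_half (R : realType) (tau : R[i]) (a b c d : int) :
  a * d - b * c = 1 -> upper_half tau ->
  upper_half ((a%:~R * tau + b%:~R) / (c%:~R * tau + d%:~R)).
Proof.
move=> det1 tauH; have J0 := moebius_denom_neq0 det1 tauH.
set w := _ / _.
have : w * (c%:~R * tau + d%:~R) = a%:~R * tau + b%:~R by rewrite divfK.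
move: w tauH {J0} => [u v]; case: tau => x y; rewrite /upper_half /= => y0.
rewrite -!(rmorph_int (real_complex R)) => /eqP.
rewrite eq_complex /= => /andP[/eqP E1 /eqP E2].
have det1R : a%:~R * d%:~R - b%:~R * c%:~R = 1 :> R.
  by rewrite -!intrM -intrB det1.
(* Im(w) |c tau + d|^2 = (ad - bc) Im(tau), from the two real equations
     contained in w (c tau + d) = a tau + b. *)
have Ev : v * ((c%:~R * x + d%:~R) ^+ 2 + (c%:~R * y) ^+ 2) = y.
  transitivity (y * (a%:~R * d%:~R - b%:~R * c%:~R)); last first.
    by rewrite det1R mulr1.
  transitivity ((c%:~R * x + d%:~R) * (a%:~R * y)
                - (c%:~R * y) * (a%:~R * x + b%:~R)); last by ring.
  have -> : a%:~R * y = u * (c%:~R * y) + v * (c%:~R * x + d%:~R).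
    by move: E2; lra.
  have -> : a%:~R * x + b%:~R = u * (c%:~R * x + d%:~R) - v * (c%:~R * y).
    by move: E1; lra.
  by ring.
rewrite ltNge; apply/negP => v0; move: y0; rewrite -Ev ltNge => /negP; apply.
by rewrite mulr_le0_ge0 // addr_ge0 ?sqr_ge0.
Qed.

(** * Heisenberg operators and the sieve *)

(** The term x y in the exponent is the normalization for which the action of
SL2(Z) on the operators is exact, without extra roots of unity: see
[slash_shift]. *)
Definition heis (R : realType) (m : nat) (tau x y : R[i]) (f : R[i] -> R[i])
    (z : R[i]) : R[i] :=
  f (z + x * tau + y) * e (m%:R * (x ^+ 2 * tau + 2 * x * z + x * y)).

Definition elliptic (R : realType) (m : nat) (tau : R[i])
    (f : R[i] -> R[i]) : Prop :=
  forall (la mu : int) (z : R[i]),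
    f (z + la%:~R * tau + mu%:~R)
      * e (m%:R * (la%:~R ^+ 2 * tau + 2 * la%:~R * z)) = f z.

(** The product over q in s of the operators 1 - V_q, V_q the shift by 1/q. *)
Fixpoint sieve (R : realType) (s : seq nat) (f : R[i] -> R[i]) (z : R[i])
    : R[i] :=
  if s is q :: s' then sieve s' f z - sieve s' f (z + q%:R^-1) else f z.

Lemma sieve_periodic (R : realType) (s : seq nat) (f : R[i] -> R[i])
    (y : R[i]) :
  (forall z, f (z + y) = f z) -> forall z, sieve s f (z + y) = sieve s f z.
Proof. by move=> fy; elim: s => //= q s IHs z; rewrite addrAC !IHs. Qed.

(** The factor 1 - V_q kills f, and it commutes with all the other factors. *)
Lemma sieve_eq0 (R : realType) (s : seq nat) (f : R[i] -> R[i]) (q : nat) :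
  q \in s -> (forall z, f (z + q%:R^-1) = f z) -> forall z, sieve s f z = 0.
Proof.
move=> + fq; elim: s => //= p s IHs; rewrite inE => /orP[/eqP <-|qs] z.
  by rewrite sieve_periodic // subrr.
by rewrite !IHs // subr0.
Qed.

Lemma sieve_sum (R : realType) (s : seq nat) (I : finType)
    (F : I -> R[i] -> R[i]) (f : R[i] -> R[i]) :
  (forall z, f z = \sum_i F i z) ->
  forall z, sieve s f z = \sum_i sieve s (F i) z.
Proof. by move=> fE; elim: s => //= q s IHs z; rewrite !IHs sumrB. Qed.

(** Integral Heisenberg operators commute with the shift by 1/q up to the root of
unity e(2 m la / q), which is 1 because q divides 2m. *)
Lemma elliptic_sieve (R : realType) (m : nat) (tau : R[i]) (s : seq nat)
    (f : R[i] -> R[i]) :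
  {in s, forall q, 0 < q /\ q %| 2 * m}%N ->
  elliptic m tau f -> elliptic m tau (sieve s f).
Proof.
move=> + fE; elim: s => //= q s IHs sP la mu z.
have {}IHs := IHs (fun p ps => sP p (@mem_behead _ (q :: s) p ps)).
have [q0 /dvdnP[t mE]] := sP q (mem_head _ _).
have nz : q%:R != 0 :> R[i] by rewrite pnatr_eq0 -lt0n.
rewrite mulrBl IHs; congr (_ - _); rewrite -[RHS](IHs la mu).
have -> : z + la%:~R * tau + mu%:~R + q%:R^-1
  = z + q%:R^-1 + la%:~R * tau + mu%:~R by ring.
congr (_ * _); apply/esym; apply: (@e_eqD_int _ _ _ (t%:Z * la)).
have -> : m%:R = t%:R * q%:R / 2 :> R[i].
  by rewrite -natrM -mE natrM mulrC mulKf ?pnatr_eq0.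
by rewrite intrM /=; field.
Qed.

(** * Compatibility with the slash action *)

Lemma det_mx22 (K : comPzRingType) (g : 'M[K]_2) :
  \det g = g ord0 ord0 * g ord_max ord_max - g ord0 ord_max * g ord_max ord0.
Proof.
rewrite (expand_det_row _ ord0) !big_ord_recl big_ord0 /cofactor !det_mx11 !mxE.
have -> : lift ord0 ord0 = ord_max :> 'I_2 by apply/val_inj.
have -> : lift ord_max 0 = ord0 :> 'I_2 by apply/val_inj.
by rewrite /= addn0 expr0 expr1 mul1r mulN1r mulrN addr0.
Qed.

(** Slashing by g turns the Heisenberg operator attached to (0,y) into the one
attached to the row vector (0,y) g = (c y, d y). *)
Lemma slash_shift (R : realType) (k : int) (m : nat) (g : 'M[int]_2)
    (y : R[i]) (F : R[i] -> R[i] -> R[i]) (tau z : R[i]) :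
  SL2Z g -> upper_half tau ->
  slash k m (fun t w => F t (w + y)) g tau z =
  heis m tau ((g ord_max ord0)%:~R * y) ((g ord_max ord_max)%:~R * y)
    (slash k m F g tau) z.
Proof.
rewrite /SL2Z /= det_mx22 /heis /slash => det1 tauH.
move: det1 (moebius_denom_neq0 det1 tauH).
move: (g ord0 ord0) (g ord0 ord_max) (g ord_max ord0) (g ord_max ord_max)
  => a b c d det1 J0.
rewrite -[in RHS]mulrA -eD; congr (F _ _ * _ * e _).
  by field.
by field.
Qed.

(** The vector (c/q, d/q) differs from (0, 1/q) by an integral vector, whose
operator fixes f.  That q^2, and not only q, divides c makes the scalar
relating the composite of the two operators to the operator of the sum equal
to 1. *)
Lemma heis_congr (R : realType) (m : nat) (tau : R[i]) (f : R[i] -> R[i])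
    (q : nat) (c d : int) (z : R[i]) :
  elliptic m tau f -> (0 < q)%N ->
  (q%:Z ^+ 2 %| c)%Z -> (q%:Z %| d - 1)%Z ->
  heis m tau (c%:~R * q%:R^-1) (d%:~R * q%:R^-1) f z = f (z + q%:R^-1).
Proof.
move=> fE q0 /dvdzP[c' ->] /dvdzP[d' dE].
have {dE} -> : d = d' * q%:Z + 1 by rewrite -dE subrK.
have nz : q%:R != 0 :> R[i] by rewrite pnatr_eq0 -lt0n.
rewrite /heis -[RHS](fE (c' * q%:Z) d'); congr (f _ * _).
  by rewrite !(rmorphM, rmorphD, rmorphXn, rmorph1) /=; field.
apply: (@e_eqD_int _ _ _ (m%:Z * (c' * q%:Z * d' - c'))).
by rewrite !(rmorphM, rmorphD, rmorphB, rmorphXn, rmorph1) /=; field.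
Qed.

(** By [slash_shift] the slash action replaces the vector (0,1/q) of each factor
by (0,1/q) g, and by [heis_congr] this does not change the factor. *)
Lemma slash_sieve (R : realType) (k : int) (m : nat) (g : 'M[int]_2)
    (s : seq nat) (phi : R[i] -> R[i] -> R[i]) :
  {in s, forall q, 0 < q /\ q %| 2 * m}%N ->
  SL2Z g ->
  {in s, forall q : nat, (q%:Z ^+ 2 %| g ord_max ord0)%Z
                   /\ (q%:Z %| g ord_max ord_max - 1)%Z} ->
  (forall tau, upper_half tau -> elliptic m tau (phi tau)) ->
  (forall tau z, upper_half tau -> slash k m phi g tau z = phi tau z) ->
  forall tau z, upper_half tau ->
    slash k m (fun t => sieve s (phi t)) g tau z = sieve s (phi tau) z.
Proof.
move=> sP gS gP phiE phiM; elim: s sP gP => [|q s IHs] sP gP tau z tauH.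
  exact: phiM.
have sP' p (ps : p \in s) := sP p (@mem_behead _ (q :: s) p ps).
have gP' p (ps : p \in s) := gP p (@mem_behead _ (q :: s) p ps).
have [q0 _] := sP q (mem_head _ _).
have [qc qd] := gP q (mem_head _ _).
pose G t := sieve s (phi t).
transitivity (slash k m G g tau z
              - slash k m (fun t w => G t (w + q%:R^-1)) g tau z).
  by rewrite /slash -!mulrBl.
rewrite slash_shift // /heis !IHs //=; congr (_ - _).
exact: heis_congr (elliptic_sieve sP' (phiE _ tauH)) q0 qc qd.
Qed.

(** * Removing the primes *)

(** Here v = sieve s phi is fixed by the Heisenberg operators of (c/p, 1/p),
(0, c/p) and their sum, while the first two compose to the third only up to
the scalar e(m c^2/p^2), which is not 1. *)
Lemma sieve_cons_eq0 (R : realType) (k : int) (m N p : nat) (s : seq nat)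
    (phi : R[i] -> R[i] -> R[i]) :
  (forall tau, upper_half tau -> elliptic m tau (phi tau)) ->
  (forall g tau z, Gamma0 N g -> upper_half tau ->
    slash k m phi g tau z = phi tau z) ->
  {in s, forall q, 0 < q /\ q %| 2 * m}%N ->
  prime p -> coprime p N -> {in s, forall q, coprime p q} ->
  ~~ (p ^ 2 %| m)%N ->
  (forall tau z, upper_half tau -> sieve (p :: s) (phi tau) z = 0) ->
  forall tau z, upper_half tau -> sieve s (phi tau) z = 0.
Proof.
move=> phiE phiM sP pr_p pN ps p2m v0 tau z tauH.
set v := fun t => sieve s (phi t).
have p0 := prime_gt0 pr_p.
have nzp : p%:R != 0 :> R[i] by rewrite pnatr_eq0 -lt0n.
have vp t w : upper_half t -> v t (w + p%:R^-1) = v t w.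
  by move=> tH; apply/eqP; rewrite eq_sym -subr_eq0; apply/eqP; exact: v0.
have vpn n w : v tau (w + n%:R / p%:R) = v tau w.
  elim: n w => [|n IHn] w; first by rewrite mul0r addr0.
  by rewrite -natr1 mulrDl mul1r addrA vp // IHn.
pose c := (N * (\prod_(q <- s) q) ^ 2)%N.
have dvd_c q : q \in s -> (q ^ 2 %| c)%N.
  by move=> qs; rewrite dvdn_mull // dvdn_exp2r // (big_rem q) //= dvdn_mulr.
have cop_c : coprime (p ^ 2) (c ^ 2).
  rewrite coprimeXl // coprimeXr // coprimeMr pN coprimeXr //=.
  rewrite big_seq; elim/big_rec: _ => [|q x qs px]; first exact: coprimen1.
  by rewrite coprimeMr ps.
(* Transport of the periodicity of v by the matrix with rows (1, d) and
     (c, d c + 1); the values d = 0 and d = 1 are used. *)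
have vheis (d : nat) :
    heis m tau (c%:R / p%:R) ((d * c + 1)%:R / p%:R) (v tau) z = v tau z.
  pose g : 'M[int]_2 := \matrix_(i, j)
    if i == ord0 then (if j == ord0 then 1 else d%:Z)
    else (if j == ord0 then c%:Z else (d * c + 1)%:Z).
  have gS : SL2Z g by rewrite /SL2Z /= det_mx22 !mxE /=; ring.
  have gG : Gamma0 N g by split=> //; rewrite mxE dvdzE /= dvdn_mulr.
  have gv t w : upper_half t -> slash k m v g t w = v t w.
    apply: slash_sieve => // [q qs|*]; last exact: phiM.
    rewrite !mxE /=; split; first exact: (dvd_c q qs).
    rewrite PoszD addrK dvdzE /= dvdn_mull //.
    by apply: dvdn_trans (dvd_c q qs); rewrite dvdn_mulr.
  have gH : upper_half (((g ord0 ord0)%:~R * tau + (g ord0 ord_max)%:~R)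
      / ((g ord_max ord0)%:~R * tau + (g ord_max ord_max)%:~R)).
    by apply: moebius_upper_half => //; rewrite -det_mx22.
  have := @slash_shift R k m g p%:R^-1 v tau z gS tauH.
  rewrite [LHS]/slash vp // -/(slash k m v g tau z) gv //.
  by rewrite /heis gv // !mxE /= => ->.
(* The two instances differ by a shift by c/p, which does not change v, and by
     the scalar e(m c^2/p^2). *)
apply: contraNeq p2m => vz; rewrite -(Gauss_dvdl _ cop_c).
apply: (@e_frac_eq1 R); first by rewrite expn_gt0 p0.
apply: (@mulfI _ (v tau z) vz); rewrite mulr1 -[RHS](vheis 1%N).
rewrite -[in LHS](vheis 0%N).
rewrite /heis mul0n add0n mul1n -[LHS]mulrA -eD.
have -> : (c + 1)%:R / p%:R = 1 / p%:R + c%:R / p%:R :> R[i].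
  by rewrite natrD mulrDl addrC.
rewrite addrA (vpn c); congr (_ * e _); rewrite [(m * _)%:R]natrM !natrX.
by field.
Qed.

Lemma sieve_eq0_inv (R : realType) (k : int) (m N : nat) (s : seq nat)
    (phi : R[i] -> R[i] -> R[i]) :
  (forall tau, upper_half tau -> elliptic m tau (phi tau)) ->
  (forall g tau z, Gamma0 N g -> upper_half tau ->
    slash k m phi g tau z = phi tau z) ->
  uniq s ->
  {in s, forall q, [/\ prime q, q %| 2 * m, coprime q N & ~~ (q ^ 2 %| m)]}%N ->
  (forall tau z, upper_half tau -> sieve s (phi tau) z = 0) ->
  forall tau z, upper_half tau -> phi tau z = 0.
Proof.
move=> phiE phiM; elim: s => [//|p s IHs] /= /andP[ps us] sP v0.
have sP' q (qs : q \in s) := sP q (@mem_behead _ (p :: s) q qs).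
have [pr_p p2m pN p2] := sP p (mem_head _ _).
apply: IHs => //; apply: (sieve_cons_eq0 phiE phiM _ pr_p pN _ p2 v0) => q qs.
  by have [/prime_gt0] := sP' q qs.
have [pr_q _ _ _] := sP' q qs.
rewrite prime_coprime // dvdn_prime2 //.
by apply: contra ps => /eqP->.
Qed.

(** * The theta functions and the theorem *)

(** The equality holds termwise, since p divides each frequency 2mn - mu. *)
Lemma Theta_periodic (R : realType) (mu p : int) (m : nat) (tau w : R[i]) :
  p != 0 -> (p %| 2 * m%:Z)%Z -> (p %| mu)%Z ->
  Theta mu m tau (w + p%:~R^-1) = Theta mu m tau w.
Proof.
move=> p0 /dvdzP[a am] /dvdzP[b ->]; rewrite /Theta; congr usum.
apply/funext => n /=.
have -> : 2 * m%:R * n - b * p = (a * n - b) * p.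
  by rewrite [m%:R]natz am; ring.
have nz : p%:~R != 0 :> R[i] by rewrite intr_eq0.
apply: (@e_eqD_int _ _ _ (a * n - b)).
by rewrite mulrDr addrA [in X in _ + X]intrM mulfK.
Qed.

Theorem theorem1 (R : realType) (k : int) (N m1 m2 : nat)
    (N_odd : odd N) (N_gt0 : (0 < N)%N)
    (m1_gt0 : (0 < m1)%N) (m1_sqf : squarefree m1)
    (m2_gt0 : (0 < m2)%N) (m2_sqf : squarefree m2)
    (m1_N : (m1 %| N)%N) (N_m2 : gcdn N m2 = 1%N)
    (phi : R[i] -> R[i] -> R[i])
    (phi_jacobi : jacobi_form k (m1 * m2) N phi)
    (phi_neq0 : exists tau z, upper_half tau /\ phi tau z <> 0)
    (h : 'I_(2 * (m1 * m2)) -> R[i] -> R[i])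
    (h_theta : theta_components phi h) :
  exists mu : 'I_(2 * (m1 * m2)),
    (gcdn mu (2 * (m1 * m2)) = 1%N \/ ~ (gcdn mu (2 * (m1 * m2)) %| 2 * m2)%N)
    /\ (exists tau, upper_half tau /\ h mu tau <> 0).
Proof.
apply: contrapT => no_mu; case: phi_neq0 => tau0 [z0 [tau0H]]; apply.
pose s := primes (2 * m2).
have sE q : q \in s = prime q && (q %| 2 * m2)%N.
  by rewrite mem_primes muln_gt0 m2_gt0.
have phiE tau : upper_half tau -> elliptic (m1 * m2) tau (phi tau).
  by move=> tauH la mu z; exact: (jacobi_elliptic phi_jacobi).
apply: (sieve_eq0_inv phiE (jacobi_modular phi_jacobi) (primes_uniq (2 * m2))
  _ _ z0 tau0H).
  move=> q; rewrite sE => /andP[pr_q q2m2].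
  (* For q = 2 this is the parity of N; any other q divides m2. *)
  have cop_qN : coprime q N.
    rewrite prime_coprime //; apply/negP => qN.
    move: q2m2; rewrite Euclid_dvdM // => /orP[|qm2].
      by rewrite dvdn_prime2 // => /eqP q2; rewrite q2 dvdn2 N_odd in qN.
    by have := dvdn_gcd q N m2; rewrite N_m2 qN qm2 dvdn1 => /eqP q1;
      rewrite q1 in pr_q.
  split=> //; first by apply: dvdn_trans q2m2 _; rewrite dvdn_pmul2l // dvdn_mull.
  have cop_qm1 : coprime q m1 := coprime_dvdr m1_N cop_qN.
  apply/negP; rewrite Gauss_dvdr ?coprimeXl // => /m2_sqf q1.
  by rewrite q1 in pr_q.
(* Each term h_mu Theta_mu of the theta expansion is killed by the sieve, either
   because h_mu vanishes or by the factor of a prime dividing (mu, 2m). *)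
move=> tau z tauH; rewrite (sieve_sum s (fun w => h_theta.2 tau w tauH)).
apply: big1 => mu _.
have [hmu0|hmu] := eqVneq (h mu tau) 0.
  apply: (@sieve_eq0 _ _ _ 2); first by rewrite sE dvdn_mulr.
  by move=> w; rewrite hmu0 !mul0r.
set d := gcdn mu (2 * (m1 * m2)).
have [d1 d2m2] : d != 1%N /\ (d %| 2 * m2)%N.
  split; [apply/negP => /eqP d1|apply: contrapT => d2m2]; apply: no_mu; exists mu;
    (split; first by [left|right]); exists tau; split=> //; exact/eqP.
have pr_p : prime (pdiv d).
  rewrite pdiv_prime // ltn_neqAle eq_sym d1 gcdn_gt0 muln_gt0 muln_gt0.
  by rewrite m1_gt0 m2_gt0 orbT.
apply: (@sieve_eq0 _ _ _ (pdiv d)).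
  by rewrite sE pr_p (dvdn_trans (pdiv_dvd d)).
move=> w; congr (_ * _); apply: (@Theta_periodic _ _ (pdiv d)).
- by rewrite eqz_nat -lt0n prime_gt0.
- by rewrite dvdzE /= (dvdn_trans (pdiv_dvd d)) // dvdn_gcdr.
- by rewrite dvdzE /= (dvdn_trans (pdiv_dvd d)) // dvdn_gcdl.
Qed.
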